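(* Let $V\subset H$ be complex Hilbert spaces with $V$ densely and continuously embedded in $H$, and let $c>0$ with $\|x\|\le c\|x\|_V$ for $x\in V$. Let $a:V\times V\to\mathbb{C}$ be a sesquilinear form with constants $M,\gamma>0$ such that $$|a(x,y)|\le M\|x\|_V\|y\|_V,\qquad \operatorname{Re}a(x,x)\ge\gamma\|x\|_V^2,\qquad x,y\in V,$$ and let $A:\mathcal{D}(A)\subset H\to H$ be the operator associated with $a$. Let $(U_n)_{n\in\mathbb{N}}$ be a sequence of finite-dimensional subspaces of $V$ with $U_n\subset U_{n+1}$, and let $A_n\in\mathcal{L}(U_n)$ be the operator associated with $a|_{U_n}$, i.e. $a(x,y)=\langle A_nx,y\rangle$ for $x,y\in U_n$. Let $W$ be a Hilbert space densely and continuously embedded into $H$ with $\mathcal{D}(A)\subset W\subset V$, and let $Q_n\in\mathcal{L}(W,V)$ be operators with range contained in $U_n$ and $\lim_{n\to\infty}\|I-Q_n\|_{\mathcal{L}(W,V)}=0$. Let $$r>0,\quad 0<\varepsilon<\frac{1}{\|A^{-1}\|}\quad\text{and}\quad \frac{\|A^{-1}\|^2\varepsilon}{1-\|A^{-1}\|\varepsilon}<\delta\le\frac{\|A^{-1}\|^2\varepsilon}{1-\|A^{-1}\|\varepsilon}+\frac72\|A^{-1}\|.$$ If $n_0\in\mathbb{N}$ is such that for every $n\ge n_0$ $$\|I-Q_n\|_{\mathcal{L}(W,V)}<\frac{\delta-\frac{\|A^{-1}\|^2\varepsilon}{1-\|A^{-1}\|\varepsilon}}{c\,\|A^{-1}\|_{\mathcal{L}(H,W)}\left(\frac{M}{\gamma}+(r+\varepsilon)\frac{7c^2}{\gamma}\right)},$$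 then $$\sigma_\varepsilon(A)\cap\overline{B_r(0)}\subset\left(B_\delta(W(A_n^{-1}))\right)^{-1}\quad\text{for all } n\ge n_0.$$
   Context: $\mathcal{L}(X,Y)$ denotes the bounded linear operators from $X$ to $Y$, $\mathcal{L}(X)=\mathcal{L}(X,X)$; $\|\cdot\|$ and $\langle\cdot,\cdot\rangle$ without subscript refer to $H$ (and operators on $H$); $I$ in $\|I-Q_n\|_{\mathcal{L}(W,V)}$ is the embedding of $W$ into $V$. The operator associated with $a$ is given by $\mathcal{D}(A)=\{x\in V: \exists c_x>0:\ |a(x,y)|\le c_x\|y\|\text{ for all }y\in V\}$ and $a(x,y)=\langle Ax,y\rangle$ for $x\in\mathcal{D}(A)$, $y\in V$. It is closed and densely defined with $0\in\varrho(A)$ and $\|A^{-1}\|\le c^2/\gamma$; likewise each $A_n$ is invertible with $\|A_n^{-1}\|\le c^2/\gamma$. By the closed graph theorem $A^{-1}\in\mathcal{L}(H,W)$. The $\varepsilon$-pseudospectrum is $\sigma_\varepsilon(A)=\sigma(A)\cup\{\lambda\in\varrho(A): \|(A-\lambda)^{-1}\|>\frac1\varepsilon\}$, with $\sigma(A)$ the spectrum and $\varrho(A)$ the resolvent set. The numerical range of an operator $T$ is $W(T)=\{\langle Tx,x\rangle: x\in\mathcal{D}(T),\ \|x\|=1\}$ (inner product of $H$; not to be confused with the space $W$). For $U\subset\mathbb{C}$ and $\delta>0$: $B_\delta(U)=\{z\in\mathbb{C}:\operatorname{dist}(z,U)<\delta\}$, $U^{-1}=\{z^{-1}: z\in U\setminus\{0\}\}$;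 $B_r(0)$ is the open disc of radius $r$ around $0$; a bar denotes closure. *)

(* Defs.v *)
From HB Require Import structures.
From mathcomp Require Import all_boot all_order all_algebra.
From mathcomp Require Import complex.
From mathcomp Require Import all_classical all_reals all_analysis.

Set Implicit Arguments.
Unset Strict Implicit.
Unset Printing Implicit Defensive.

Import Order.TTheory GRing.Theory Num.Theory.
Import numFieldNormedType.Exports.

Local Open Scope classical_set_scope.
Local Open Scope ring_scope.
Local Open Scope complex_scope.

(* Inner products are linear in the first argument and conjugate-linear in the
   second one. *)
HB.mixin Record isHilbert (R : realType) H
    of CompleteNormedModule R[i] H := {
  inner : {dot H for (@Num.conj R[i])};
  inner_norm : forall x : H, inner x x = `|x| ^+ 2
}.

#[short(type="hilbertType")]
HB.structure Definition Hilbert (R : realType) :=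
  {H of isHilbert R H & CompleteNormedModule R[i] H}.

(* The norm of a normed space over R[i] takes its (real) values in R[i]. *)
Definition nrm (R : realType) (X : normedZmodType R[i]) (x : X) : R :=
  complex.Re `|x|.
Arguments nrm {R X} x.

(* A sesquilinear form on V, with the same convention as for [inner]. *)
Notation "{ 'sesquilinear' V 'over' R }" :=
  {bilinear V -> V -> R[i] | *%R & (@Num.conj R[i]) \; *%R}
  (at level 0, V at level 99, R at level 99) : type_scope.

(* A possibly unbounded operator; the values of [fn] outside of [dom] are
   irrelevant. *)
Record operator (X Y : Type) := Operator { dom : set X; fn :> X -> Y }.

Definition total_op (X Y : Type) (f : X -> Y) : operator X Y := Operator setT f.

Section operators.
Variables (R : realType).

(* [+oo] if [T] is unbounded; only vectors of the domain of [T] count. *)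
Definition opnorm (X Y : normedModType R[i]) (T : operator X Y) : \bar R :=
  ereal_sup [set (nrm (T x))%:E | x in [set x | dom T x /\ nrm x <= 1]].

Definition inv_op (X Y : lmodType R[i]) (T : operator X Y) : operator Y X :=
  Operator (T @` dom T) ('pinv_(fun=> 0) (dom T) T).

Definition shift (X : lmodType R[i]) (T : operator X X) (l : R[i]) :
  operator X X := Operator (dom T) (fun x => T x - l *: x).

(* The operator [T : X -> Y] seen as an operator into [Z], where the injection
   [e : Z -> Y] identifies [Z] with a subspace of [Y] containing the range of
   [T]. *)
Definition corestrict (X Y Z : lmodType R[i]) (e : Z -> Y) (T : operator X Y) :
  operator X Z := Operator (dom T) ('pinv_(fun=> 0) setT e \o T).

Definition resolvent_set (X : normedModType R[i]) (T : operator X X) :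
    set R[i] :=
  [set l | set_bij (dom T) setT (shift T l) /\
           (opnorm (inv_op (shift T l)) < +oo)%E].

Definition spectrum (X : normedModType R[i]) (T : operator X X) : set R[i] :=
  ~` resolvent_set T.

Definition pseudospectrum (X : normedModType R[i]) (eps : R)
    (T : operator X X) : set R[i] :=
  spectrum T `|`
  [set l | resolvent_set T l /\
           ((eps^-1)%:E < opnorm (inv_op (shift T l)))%E].

Definition numerical_range (H : hilbertType R) (T : operator H H) : set R[i] :=
  [set inner (T x) x | x in [set x | dom T x /\ nrm x = 1]].

Definition dist (z : R[i]) (S : set R[i]) : \bar R :=
  ereal_inf [set (nrm (z - s))%:E | s in S].

(* [dist z set0 = +oo], hence [nbhd delta set0 = set0]. *)
Definition nbhd (delta : R) (S : set R[i]) : set R[i] :=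
  [set z | (dist z S < delta%:E)%E].

Definition inv_set (S : set R[i]) : set R[i] :=
  [set z^-1 | z in S `\ 0].

(* [R[i]^o] rather than [R[i]], as the former carries the topology. *)
Definition disc (r : R) : set R[i]^o := [set z | nrm z < r].

Definition finite_dim_subspace (X : lmodType R[i]) (U : set X) : Prop :=
  exists (m : nat) (b : 'I_m -> X),
    U = [set x | exists k : 'I_m -> R[i], x = \sum_i k i *: b i].

(* In the next two definitions the Hilbert space [V] is regarded as a subspace
   of [H] by means of the injection [j : V -> H]. On its domain, the value of
   [form_op] exists by Riesz' theorem and is unique since [j] is injective with
   dense range; likewise for [form_op_on U], whose values are taken in [j @` U]
   and which is meant for finite-dimensional [U]. *)
Section form.
Variables (H V : hilbertType R) (j : V -> H) (a : V -> V -> R[i]).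

Definition form_domain : set V :=
  [set x | exists2 k : R, 0 < k & forall y, nrm (a x y) <= k * nrm (j y)].

Definition form_op : operator H H :=
  Operator (j @` form_domain)
    (fun h => xget 0 [set f | exists2 x, j x = h &
                                forall y, a x y = inner f (j y)]).

Definition form_op_on (U : set V) : operator H H :=
  Operator (j @` U)
    (fun h => xget 0 [set f | (j @` U) f /\ exists2 x, U x /\ j x = h &
                                forall y, U y -> a x y = inner f (j y)]).

End form.

End operators.

(* Main.v *)
Require Import Defs.
From HB Require Import structures.
From mathcomp Require Import all_boot all_order all_algebra.
From mathcomp Require Import complex.
From mathcomp Require Import ring lra.
From mathcomp Require Import all_classical all_reals all_analysis.

Set Implicit Arguments.
Unset Strict Implicit.
Unset Printing Implicit Defensive.

Import Order.TTheory GRing.Theory Num.Theory.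
Import numFieldNormedType.Exports.

Local Open Scope classical_set_scope.
Local Open Scope ring_scope.
Local Open Scope complex_scope.

(** Let [T = A^-1].  If [l] lies in the [eps]-pseudospectrum, there is a unit
    vector [h] in the domain of [A] with [|A h - l h| < eps], and then
    [<T h, h>] is within [delta0] of [l^-1].  (If [l] is in the spectrum, this
    uses the Fredholm alternative: [T] differs from the finite-rank operator
    [Q_n T] by less than [1 / |l|] in norm.)  As [|A h| <= r + eps], the vector
    [h] is close to the normalisation [y] of [Q_n h], and by Cea's lemma [T y]
    is close to the Galerkin solution [A_n^-1 y], so that [<A_n^-1 y, y>] is
    within [delta] of [l^-1]. *)

(** * Real-valued norms of complex vectors *)

Section norm.
Variable R : realType.

Lemma nrmE (X : normedZmodType R[i]) (x : X) : `|x| = (nrm x)%:C.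
Proof. by rewrite /nrm RRe_real// ger0_real. Qed.

Lemma nrm_ge0 (X : normedZmodType R[i]) (x : X) : 0 <= nrm x.
Proof. by rewrite -ler0c -nrmE. Qed.

Lemma nrm0 (X : normedZmodType R[i]) : nrm (0 : X) = 0.
Proof. by rewrite /nrm normr0. Qed.

Lemma nrm_eq0 (X : normedZmodType R[i]) (x : X) : nrm x = 0 -> x = 0.
Proof. by move=> x0; apply/normr0_eq0; rewrite nrmE x0. Qed.

Lemma nrmN (X : normedZmodType R[i]) (x : X) : nrm (- x) = nrm x.
Proof. by rewrite /nrm normrN. Qed.

Lemma nrm_subC (X : normedZmodType R[i]) (x y : X) : nrm (x - y) = nrm (y - x).
Proof. by rewrite /nrm distrC. Qed.

Lemma ler_nrmD (X : normedZmodType R[i]) (x y : X) :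
  nrm (x + y) <= nrm x + nrm y.
Proof. by rewrite -lecR rmorphD/= -!nrmE ler_normD. Qed.

Lemma ler_nrmB (X : normedZmodType R[i]) (x y : X) :
  nrm (x - y) <= nrm x + nrm y.
Proof. by rewrite -(nrmN y) ler_nrmD. Qed.

Lemma nrmM (x y : R[i]) : nrm (x * y : R[i]) = nrm x * nrm y.
Proof. by apply: complexI; rewrite rmorphM/= -!nrmE normrM. Qed.

Lemma nrmV (x : R[i]) : nrm (x^-1 : R[i]) = (nrm x)^-1.
Proof. by apply: complexI; rewrite fmorphV/= -!nrmE normfV. Qed.

Lemma nrmZ (X : normedModType R[i]) (k : R[i]) (x : X) :
  nrm (k *: x) = nrm k * nrm x.
Proof. by apply: complexI; rewrite rmorphM/= -!nrmE normrZ. Qed.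

Lemma nrm_real (x : R) : nrm x%:C = `|x|.
Proof. by rewrite /nrm normc_def/= expr0n addr0 sqrtr_sqr. Qed.

Lemma nrm_conj (x : R[i]) : nrm (Num.conj x : R[i]) = nrm x.
Proof. by rewrite /nrm norm_conjC. Qed.

Lemma Re_conj (x : R[i]) : complex.Re (Num.conj x) = complex.Re x.
Proof. by case: x. Qed.

Lemma Re_le_nrm (x : R[i]) : complex.Re x <= nrm x.
Proof. by rewrite (le_trans (ler_norm _))// -lecR -nrmE normc_ge_Re. Qed.

Lemma conj_real (x : R) : Num.conj x%:C = x%:C.
Proof. exact: conjc_real. Qed.

Lemma mul_conj_nrm (x : R[i]) : Num.conj x * x = (nrm x ^+ 2)%:C.
Proof. by rewrite rmorphXn/= -nrmE normCK mulrC. Qed.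

End norm.

(** * Inner products, and completeness along sequences *)

Section inner.
Variables (R : realType) (H : hilbertType R).
Implicit Types x y z : H.

Lemma innerC x y : inner x y = Num.conj (inner y x).
Proof. by rewrite hermC expr0 mul1r. Qed.

Lemma innerDl x y z : inner (x + y) z = inner x z + inner y z.
Proof. exact: linearDl. Qed.

Lemma innerDr x y z : inner z (x + y) = inner z x + inner z y.
Proof. exact: linearDr. Qed.

Lemma innerBl x y z : inner (x - y) z = inner x z - inner y z.
Proof. exact: linearBl. Qed.

Lemma innerBr x y z : inner z (x - y) = inner z x - inner z y.
Proof. exact: linearBr. Qed.

Lemma innerZl k x y : inner (k *: x) y = k * inner x y.
Proof. by rewrite linearZl_LR. Qed.

Lemma innerZr k x y : inner x (k *: y) = Num.conj k * inner x y.
Proof. by rewrite linearZr_LR. Qed.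

Lemma inner_nrm x : inner x x = (nrm x ^+ 2)%:C.
Proof. by rewrite inner_norm nrmE rmorphXn. Qed.

Lemma nrm_sqrD x y :
  nrm (x + y) ^+ 2 = nrm x ^+ 2 + nrm y ^+ 2 + 2 * complex.Re (inner x y).
Proof.
have E z : nrm z ^+ 2 = complex.Re (inner z z) by rewrite inner_nrm.
rewrite !E innerDl !innerDr (innerC y x) !raddfD/= Re_conj; ring.
Qed.

Lemma cauchy_schwarz x y : nrm (inner x y) <= nrm x * nrm y.
Proof.
have [y0|y0] := eqVneq (nrm y) 0.
  by rewrite (nrm_eq0 y0) linear0r !nrm0 mulr0.
have yp : 0 < nrm y ^+ 2 by rewrite exprn_gt0// lt_def y0 nrm_ge0.
pose s := (nrm y ^+ 2)^-1.
have sy : s * nrm y ^+ 2 = 1 by rewrite mulVf// gt_eqF.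
(* This [k] minimises the norm of [x + k *: y]; expanding the square there gives the inequality. *)
have /(_ (- (s%:C * inner x y))) E k : 0 <= nrm (x + k *: y) ^+ 2.
  exact: sqr_ge0.
rewrite nrm_sqrD nrmZ nrmN innerZr rmorphN rmorphM/= in E.
rewrite conj_real mulNr raddfN in E.
rewrite -mulrA mul_conj_nrm -rmorphM/= nrmM nrm_real ger0_norm in E; last first.
  by rewrite invr_ge0 ltW.
rewrite -(ler_pXn2r (n := 2))// ?nnegrE ?mulr_ge0 ?nrm_ge0//.
rewrite exprMn -ler_pdivrMr// -/s.
set p := nrm (inner x y) ^+ 2.
have e2 : (s * nrm (inner x y) * nrm y) ^+ 2 = s * p.
  by rewrite /p -[RHS]mul1r -sy; ring.
by move: E; rewrite e2 -/p; lra.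
Qed.

Lemma inner_inj x y : (forall z, inner x z = inner y z) -> x = y.
Proof.
move=> xy; apply/subr0_eq/nrm_eq0/eqP; rewrite -sqrf_eq0; apply/eqP.
by apply: complexI; rewrite -inner_nrm innerBl xy subrr.
Qed.

End inner.

(** Shaped for minimising sequences, where the parallelogram law bounds squared distances by energy
    gaps, here [n.+1%:R^-1]. A single index serves both smallness conditions. *)
Lemma complete_seq (R : realType) (X : completeNormedModType R[i])
    (u : nat -> X) (K : R) :
  (forall n m, nrm (u n - u m) ^+ 2 <= K * (n.+1%:R^-1 + m.+1%:R^-1)) ->
  exists l, forall e, 0 < e ->
    exists n, nrm (l - u n) < e /\ n.+1%:R^-1 < e.
Proof.
move=> uK.
have K0 : 0 <= K.
  have := le_trans (sqr_ge0 _) (uK 0%N 0%N).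
  by rewrite invr1 pmulr_lge0// addr_gt0.
have small (e : R) : 0 < e -> \forall n \near \oo, n.+1%:R^-1 < e.
  by move=> e0; exact: near_infty_natSinv_lt (PosNum e0).
have ucvg : cvg (u @ \oo).
  apply/cauchy_cvgP/cauchy_ballP => e e0; near_simpl.
  (* Positive elements of [R[i]] are real, so the radius can be moved to [R]. *)
  have eE : e = (complex.Re e)%:C by rewrite RRe_real// gtr0_real.
  have {}e0 : 0 < complex.Re e by move: e0; rewrite eE ltcR.
  rewrite eE; move: (complex.Re e) e0 => {eE}e e0.
  (* [K + 1] in place of [K] keeps the denominator positive when [K = 0]. *)
  have e1 : 0 < e ^+ 2 / (2 * (K + 1)).
    by rewrite divr_gt0 ?exprn_gt0// mulr_gt0// ltr_wpDl.
  near=> n m.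
  rewrite -ball_normE/= nrmE ltcR.
  rewrite -(ltr_pXn2r (n := 2))// ?nnegrE ?nrm_ge0 ?ltW//.
  apply: le_lt_trans (uK _ _) _.
  have : n.+1%:R^-1 < e ^+ 2 / (2 * (K + 1)) by near: n; exact: small.
  have : m.+1%:R^-1 < e ^+ 2 / (2 * (K + 1)) by near: m; exact: small.
  rewrite !ltr_pdivlMr ?mulr_gt0 ?ltr_wpDl//.
  have : 0 <= n.+1%:R^-1 :> R by [].
  have : 0 <= m.+1%:R^-1 :> R by [].
  by move: n.+1%:R^-1 m.+1%:R^-1 => a b; lra.
exists (lim (u @ \oo)) => e e0.
near \oo => n; exists n; split.
  rewrite -ltcR -nrmE; near: n.
  by move/cvgrPdist_lt: ucvg; apply; rewrite ltcR.
by near: n; exact: small.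
Unshelve. all: by end_near. Qed.

(** * Antilinear functionals and Riesz representation *)

Section antilinear.
Variables (R : realType) (V : lmodType R[i]).
Implicit Type phi : V -> R[i].

Definition antilinear phi :=
  forall k x y, phi (k *: x + y) = Num.conj k * phi x + phi y.

Lemma antilinear0 phi : antilinear phi -> phi 0 = 0.
Proof.
move=> /(_ 1 0 0); rewrite scaler0 addr0 rmorph1 mul1r => /eqP.
by rewrite -subr_eq0 opprD addrA subrr sub0r oppr_eq0 => /eqP.
Qed.

Lemma antilinearZ phi k x : antilinear phi -> phi (k *: x) = Num.conj k * phi x.
Proof. by move=> phil; rewrite -[k *: x]addr0 phil antilinear0// addr0. Qed.

End antilinear.

Lemma inner_antilinear (R : realType) (H : hilbertType R) (x : H) :
  antilinear (inner x).
Proof. by move=> k y z; rewrite innerDr innerZr. Qed.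

(* The representing vector is the limit of [C (u n)] for a minimising sequence
   [u] of [J x = |C x|^2 - 2 Re (phi x)]; it is Cauchy by the parallelogram
   law. *)
Lemma riesz_range (R : realType) (V : lmodType R[i]) (X : hilbertType R)
    (C : V -> X) (phi : V -> R[i]) (F : R) :
  linear C -> antilinear phi -> 0 <= F ->
  (forall x, nrm (phi x) <= F * nrm (C x)) ->
  exists f, forall y, inner f (C y) = phi y.
Proof.
move=> Cl phil F0 phile.
have CD x y : C (x + y) = C x + C y by rewrite -[x in LHS]scale1r Cl scale1r.
have CZ l x : C (l *: x) = l *: C x.
  have C0 : C 0 = 0 by apply: (addrI (C 0)); rewrite -CD !addr0.
  by rewrite -[l *: x]addr0 Cl C0 addr0.
have phiD x y : phi (x + y) = phi x + phi y.
  by rewrite -[x in LHS]scale1r phil rmorph1 mul1r.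
pose J x := nrm (C x) ^+ 2 - 2 * complex.Re (phi x).
have JD x v : J (x + v) =
    J x + nrm (C v) ^+ 2 + 2 * complex.Re (inner (C x) (C v) - phi v).
  by rewrite /J CD phiD nrm_sqrD !raddfD/= raddfN/=; ring.
have J_lb : has_lbound (range J).
  (* [J x >= |C x|^2 - 2 F |C x| = (|C x| - F)^2 - F^2]. *)
  exists (- F ^+ 2) => _ [x _ <-].
  have := le_trans (Re_le_nrm _) (phile x).
  by rewrite /J; have := sqr_ge0 (nrm (C x) - F); nra.
set m := inf (range J).
have m_le x : m <= J x by apply: ge_inf => //; exists x.
have Jinf : has_inf (range J) by split=> //; exists (J 0), 0.
have /choice[u uP] n : exists x, J x < m + n.+1%:R^-1.
  have n0 : 0 < n.+1%:R^-1 :> R by [].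
  by have [_ [x _ <-] xm] := inf_adherent n0 Jinf; exists x.
have [|l lP] := @complete_seq _ _ (C \o u) 2.
  (* [u p + h] is the midpoint of [u p] and [u n]. Expanding by [JD] gives [J (u n) + J (u p) - 2 J
     (u p + h) = 2 |C h|^2], whence the constant [2]. *)
  move=> n p; pose h := 2^-1 *: (u n - u p).
  have un : u n = u p + h + h.
    rewrite -addrA -scalerDl; have -> : 2^-1 + 2^-1 = 1 :> R[i] by field.
    by rewrite scale1r addrC subrK.
  have -> : (C \o u) n - (C \o u) p = 2%:C *: C h.
    rewrite /= un !CD -(addrA (C (u p))) [LHS]addrC addKr.
    by rewrite rmorph_nat scaler_nat mulr2n.
  rewrite nrmZ nrm_real ger0_norm//.
  have := m_le (u p + h); have := uP n; have := uP p.
  rewrite un !JD CD innerDl [_ + _ - phi h]addrAC.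
  move: (_ - phi h) => q; rewrite [complex.Re (q + _)]raddfD/= inner_nrm/=.
  move: n.+1%:R^-1 p.+1%:R^-1 => a b; lra.
suff D0 y : inner l (C y) - phi y = 0.
  by exists l => y; apply/subr0_eq.
(* [2 Re (D v)] is the first variation at the limit. As [l] need not lie in the range of [C],
   minimality is used through [m <= J (u n + v)] for large [n]. *)
pose D v := inner l (C v) - phi v.
have D_ge v : 0 <= nrm (C v) ^+ 2 + 2 * complex.Re (D v).
  apply/ler_addgt0Pl => e e0; pose t := 1 + 2 * nrm (C v).
  have t0 : 0 < t by rewrite ltr_wpDr// mulr_ge0// nrm_ge0.
  have [n [ln ne]] := lP (e / t) (divr_gt0 e0 t0).
  have := m_le (u n + v); have := uP n; rewrite JD.
  have -> : D v = inner (l - C (u n)) (C v) + (inner (C (u n)) (C v) - phi v).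
    by rewrite addrA -innerDl subrK.
  rewrite raddfD/=.
  have : - (e / t * nrm (C v)) <= complex.Re (inner (l - C (u n)) (C v)).
    rewrite lerNl -raddfN (le_trans (Re_le_nrm _))// nrmN.
    by rewrite (le_trans (cauchy_schwarz _ _))// ler_wpM2r ?nrm_ge0// ltW.
  have : e / t + 2 * (e / t * nrm (C v)) = e.
    rewrite -[RHS](divfK (lt0r_neq0 t0)); move: (e / t) => b.
    by rewrite /t; ring.
  move: ne; move: n.+1%:R^-1 (e / t) => a b; lra.
(* At [v = - s (D y) y], [D_ge] reads [s |D y|^2 (2 - s |C y|^2) <= 0]; [s] is chosen so that
   [s |C y|^2 < 1], which forces [D y = 0]. *)
pose s := (1 + nrm (C y) ^+ 2)^-1.
have s0 : 0 < s by rewrite invr_gt0 ltr_wpDr// sqr_ge0.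
have := D_ge ((- (s%:C * D y)) *: y).
have DZ k v : D (k *: v) = Num.conj k * D v.
  by rewrite /D CZ innerZr antilinearZ// mulrBr.
rewrite DZ rmorphN rmorphM/= conj_real mulNr -mulrA mul_conj_nrm -rmorphM/=.
rewrite CZ nrmZ nrmN nrmM nrm_real (ger0_norm (ltW s0)) => sD.
have sC : s * nrm (C y) ^+ 2 < 1.
  by rewrite mulrC ltr_pdivrMr ?ltr_wpDr ?sqr_ge0// mul1r ltrDr.
apply: nrm_eq0; apply/eqP; rewrite -sqrf_eq0 eq_le sqr_ge0 andbT.
rewrite -/(D y) leNgt; apply/negP => D0.
have p1 : 0 < s * nrm (D y) ^+ 2 by exact: mulr_gt0.
have p2 : 0 < 2 - s * nrm (C y) ^+ 2 by move: sC; lra.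
have := mulr_gt0 p1 p2; move: sD.
by move: (nrm _) (nrm _) => c d; nra.
Qed.

Lemma submx_coker (F : fieldType) (m n p : nat) (A : 'M[F]_(m, n))
    (B : 'M[F]_(p, n)) :
  (forall c : 'cV_n, B *m c = 0 -> A *m c = 0) -> (A <= B)%MS.
Proof.
move=> BA; rewrite submxE; apply/eqP/matrixP => i j.
have /BA/matrixP/(_ i 0) : B *m col j (cokermx B) = 0.
  by rewrite colE mulmxA mulmx_coker mul0mx.
by rewrite colE mulmxA -colE !mxE.
Qed.

(** Rank-nullity turns the inclusion of left kernels into [\rank B <= \rank A], so the inclusion of
    row spaces is an equality. *)
Lemma submx_kermx_sub (F : fieldType) (m n : nat) (A B : 'M[F]_(m, n)) :
  (A <= B)%MS -> (kermx A <= kermx B)%MS -> (B <= A)%MS.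
Proof.
move=> AB /mxrankS; rewrite -(geq_leqif (mxrank_leqif_sup AB)) !mxrank_ker.
by rewrite leq_sub2lE// rank_leq_row.
Qed.

(** * Solving variational equations *)

Section forms.
Variables (R : realType) (V : hilbertType R) (f : V -> V -> R[i]).
Hypothesis f_l : forall k x y z, f (k *: x + y) z = k * f x z + f y z.
Hypothesis f_r : forall x, antilinear (f x).
Implicit Type phi : V -> R[i].

(* By Riesz [f x y = <x, C y>], where [C] is bounded below since [f] is
   coercive, so that [riesz_range] applies to [C]. *)
Lemma lax_milgram phi (g M F : R) : 0 < g -> 0 <= M -> 0 <= F ->
  (forall x y, nrm (f x y) <= M * nrm x * nrm y) ->
  (forall x, g * nrm x ^+ 2 <= nrm (f x x)) ->
  antilinear phi -> (forall x, nrm (phi x) <= F * nrm x) ->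
  exists x, forall y, f x y = phi y.
Proof.
move=> g0 M0 F0 fle fge phil phile.
(* Conjugation makes [f x y] antilinear in [x], as Riesz requires. *)
have /choice[C CE] y : exists z, forall x, inner z x = Num.conj (f x y).
  apply: (@riesz_range _ _ _ id _ (M * nrm y)) => //.
  - by move=> k x x'; rewrite f_l rmorphD rmorphM.
  - by rewrite mulr_ge0// nrm_ge0.
  - by move=> x; rewrite nrm_conj mulrAC.
have Cl : linear C.
  move=> k x y; apply: inner_inj => z.
  by rewrite innerDl innerZl !CE f_r rmorphD rmorphM /= conjCK.
have Cge x : g * nrm x <= nrm (C x).
  have [->|x0] := eqVneq (nrm x) 0; first by rewrite mulr0 nrm_ge0.
  have x1 : 0 < nrm x by rewrite lt_def x0 nrm_ge0.
  rewrite -(ler_pM2r x1) -mulrA -expr2 (le_trans (fge _))//.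
  by rewrite -nrm_conj -CE cauchy_schwarz.
have [|x|z zP] := @riesz_range _ _ _ C phi (F / g) Cl phil.
- by rewrite divr_ge0// ltW.
- by rewrite (le_trans (phile x))// -mulrA ler_wpM2l// ler_pdivlMl.
by exists z => y; rewrite -zP innerC CE conjCK.
Qed.

(* The matrix of [f] on a spanning family (which may be linearly dependent) has
   the same row space as its Gram matrix. *)
Lemma findim_form_solve (U : set V) phi : finite_dim_subspace U ->
  (forall x, U x -> (forall y, U y -> f x y = 0) -> x = 0) ->
  antilinear phi ->
  exists2 x, U x & forall y, U y -> f x y = phi y.
Proof.
move=> [m [b ->]] f0 phil.
pose comb (k : 'I_m -> R[i]) := \sum_i k i *: b i.
pose G := \matrix_(i, j) f (b i) (b j).
pose G0 := \matrix_(i, j) inner (b i) (b j).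
pose v := \row_j phi (b j).
have f0l y : f 0 y = 0.
  by have := f_l (-1) 0 0 y; rewrite scaler0 addr0 mulN1r addNr.
have f_comb k y : f (comb k) y = \sum_i k i * f (b i) y.
  rewrite /comb (big_morph (f^~ y) (id1 := 0) (op1 := +%R)) ?f0l//.
    by apply: eq_bigr => i _; rewrite -[k i *: b i]addr0 f_l f0l addr0.
  by move=> x z; rewrite -[x]scale1r f_l mul1r scale1r.
have phi_comb (psi : V -> R[i]) k : antilinear psi ->
    psi (comb k) = \sum_i Num.conj (k i) * psi (b i).
  move=> psil; rewrite /comb (big_morph psi (id1 := 0) (op1 := +%R)).
  - by apply: eq_bigr => i _; rewrite antilinearZ.
  - by move=> x z; rewrite -[x]scale1r psil rmorph1 mul1r scale1r.
  - exact: antilinear0.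
have inner_r := @inner_antilinear R V.
have inner_l x y : inner (comb x) y = \sum_i x i * inner (b i) y.
  rewrite /comb (big_morph ((@inner _ _)^~ y) (id1 := 0) (op1 := +%R)).
  - by apply: eq_bigr => i _; rewrite innerZl.
  - by move=> x1 x2; rewrite innerDl.
  - exact: linear0l.
(* A kernel vector [c] of the Gram matrix yields a [w] orthogonal to every [b i], hence [w = 0]. The
   conjugate of [c] is thus a linear relation between the [b i], which every antilinear [psi]
   respects. *)
have comb_ker (psi : V -> R[i]) (c : 'cV_m) : antilinear psi -> G0 *m c = 0 ->
    \sum_j psi (b j) * c j 0 = 0.
  move=> psil /matrixP G0c; pose w := comb (fun j => Num.conj (c j 0)).
  have E (chi : V -> R[i]) : antilinear chi ->
      \sum_j chi (b j) * c j 0 = chi w.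
    move=> chil; rewrite phi_comb//; apply: eq_bigr => j _.
    by rewrite conjCK mulrC.
  suff w0 : w = 0 by rewrite E// w0 antilinear0.
  apply: nrm_eq0; apply/eqP; rewrite -sqrf_eq0; apply/eqP/complexI.
  rewrite -inner_nrm inner_l big1// => i _.
  rewrite -E//; have := G0c i 0; rewrite !mxE => G0ci.
  rewrite (_ : \sum_j _ = 0) ?mulr0// -[RHS]G0ci.
    by apply: eq_bigr => j _; rewrite mxE.
have G_G0 : (G <= G0)%MS.
  apply: submx_coker => c G0c; apply/matrixP => i j.
  rewrite !mxE ord1 -[RHS](comb_ker _ _ (f_r (b i)) G0c); apply: eq_bigr => k _.
  by rewrite [G i k]mxE.
have v_G0 : (v <= G0)%MS.
  apply: submx_coker => c G0c; apply/matrixP => i j.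
  rewrite !mxE (ord1 j) -[RHS](comb_ker _ _ phil G0c); apply: eq_bigr => k _.
  by rewrite mxE.
(* A left kernel vector of [G] gives a combination of the [b i] on which [f] vanishes against all of
   [U]; by non-degeneracy this combination is [0]. *)
have ker_G : (kermx G <= kermx G0)%MS.
  apply/row_subP => i; apply/sub_kermxP; set x := row i _.
  have /matrixP xG : x *m G = 0 by rewrite -row_mul mulmx_ker row0.
  have x0 : comb (x 0) = 0.
    apply: f0 => [|y [k ->]]; first by exists (x 0).
    rewrite phi_comb// big1// => j _; rewrite f_comb.
    rewrite (_ : \sum_l _ = 0) ?mulr0//.
    have := xG 0 j; rewrite !mxE => {}xG; rewrite -[RHS]xG.
    by apply: eq_bigr => l _; rewrite [G _ _]mxE.
  apply/matrixP => r j; rewrite mxE ord1 [RHS]mxE.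
  transitivity (inner (comb (x 0)) (b j)); last by rewrite x0 linear0l.
  by rewrite inner_l; apply: eq_bigr => k _; rewrite [G0 _ _]mxE.
have G0_G := submx_kermx_sub G_G0 ker_G.
have /submxP[D vD] := submx_trans v_G0 G0_G.
exists (comb (D 0)) => [|_ [k ->]]; first by exists (D 0).
rewrite !phi_comb//; apply: eq_bigr => j _; congr (_ * _).
transitivity (v 0 j); last by rewrite mxE.
by rewrite vD mxE f_comb; apply: eq_bigr => l _; rewrite mxE.
Qed.

End forms.

(** * Operator norms, and linear operators with a domain *)

Section operators.
Variables (R : realType) (X Y : normedModType R[i]).
Implicit Type T : operator X Y.

Lemma inv_opP T y : (T @` dom T) y ->
  dom T (inv_op T y) /\ T (inv_op T y) = y.
Proof.
move=> yT; split; last by rewrite /inv_op/= pinvK// inE.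
have Tsurj : set_surj (dom T) (T @` dom T) T by [].
by apply: (surjpinv_image_sub Tsurj); exists y.
Qed.

Lemma opnorm_le T (k : R) :
  (forall x, dom T x -> nrm x <= 1 -> nrm (T x) <= k) -> (opnorm T <= k%:E)%E.
Proof.
by move=> Tk; apply: ge_ereal_sup => _ [x [? ?] <-]; rewrite lee_fin Tk.
Qed.

Lemma opnorm_ge0 T : dom T 0 -> (0 <= opnorm T)%E.
Proof.
move=> T0; apply: (@le_trans _ _ (nrm (T 0))%:E).
  by rewrite lee_fin nrm_ge0.
by apply: ereal_sup_ubound; exists 0 => //; split=> //; rewrite nrm0.
Qed.

Lemma opnorm_ub T (x : X) : (opnorm T < +oo)%E ->
  (forall k x, dom T x -> dom T (k *: x) /\ T (k *: x) = k *: T x) ->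
  dom T x -> nrm (T x) <= fine (opnorm T) * nrm x.
Proof.
move=> Tfin TZ Tx.
have [x0|x0] := eqVneq (nrm x) 0.
  have [_] := TZ 0 x Tx; rewrite (nrm_eq0 x0) !scale0r => ->.
  by rewrite !nrm0 mulr0.
have xp : 0 < nrm x by rewrite lt_def x0 nrm_ge0.
have T0 : dom T 0 by have [] := TZ 0 x Tx; rewrite scale0r.
have finT : opnorm T \is a fin_num by rewrite ge0_fin_numE ?opnorm_ge0.
have [Tkx Tkx_eq] := TZ ((nrm x)^-1)%:C x Tx.
have kx : nrm ((nrm x)^-1)%:C = (nrm x)^-1.
  by rewrite nrm_real ger0_norm// invr_ge0 ltW.
have : ((nrm (T (((nrm x)^-1)%:C *: x)))%:E <= opnorm T)%E.
  apply: ereal_sup_ubound; exists (((nrm x)^-1)%:C *: x) => //; split=> //.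
  by rewrite nrmZ kx mulVf.
by rewrite -(fineK finT) lee_fin Tkx_eq nrmZ kx ler_pdivrMl// mulrC.
Qed.

End operators.

Definition linear_op (R : realType) (X Y : lmodType R[i]) (T : operator X Y) :=
  dom T 0 /\ forall k x y, dom T x -> dom T y ->
    dom T (k *: x + y) /\ T (k *: x + y) = k *: T x + T y.

Section linear_op.
Variables (R : realType) (X Y : normedModType R[i]) (T : operator X Y).
Hypothesis Tl : linear_op T.

Lemma linear_op0 : T 0 = 0.
Proof.
have [T0 TD] := Tl; have [_] := TD (-1) 0 0 T0 T0.
by rewrite scaler0 addr0 scaleN1r addNr.
Qed.

Lemma linear_opZ k x : dom T x -> dom T (k *: x) /\ T (k *: x) = k *: T x.
Proof.
have [T0 TD] := Tl => Tx; have := TD k x 0 Tx T0.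
by rewrite linear_op0 !addr0.
Qed.

Lemma linear_opB x y : dom T x -> dom T y ->
  dom T (x - y) /\ T (x - y) = T x - T y.
Proof.
have [T0 TD] := Tl => Tx Ty; have := TD (-1) y x Ty Tx.
by rewrite !scaleN1r ![- _ + _]addrC.
Qed.

End linear_op.

(** * Pseudospectra and approximate eigenvectors *)

Section pseudospectrum.
Variables (R : realType) (X : normedModType R[i]) (T : operator X X).
Hypothesis Tl : linear_op T.

Lemma linear_shift l : linear_op (Defs.shift T l).
Proof.
have [T0 TD] := Tl; split=> // k x y Tx Ty; have [Txy E] := TD k x y Tx Ty.
split=> //=; rewrite E scalerDr !scalerA scalerBr scalerA (mulrC k) opprD.
by rewrite addrACA.
Qed.

(** Without such an [x], [T - l] is bounded below by [eps], hence injective, hence surjective by the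
    Fredholm-type hypothesis. Its inverse then has norm at most [eps^-1], so [l] lies in neither
    part of the pseudospectrum. *)
Lemma pseudospectrum_approx (eps : R) l : 0 < eps ->
  ((forall x, dom T x -> T x = l *: x -> x = 0) ->
   forall y, exists2 x, dom T x & T x - l *: x = y) ->
  pseudospectrum eps T l ->
  exists x, [/\ dom T x, nrm x = 1 & nrm (T x - l *: x) < eps].
Proof.
move=> eps0 inj_surj lT; apply: contrapT => no_x.
have Sl := linear_shift l.
have Tge x : dom T x -> eps * nrm x <= nrm (T x - l *: x).
  move=> Tx; have [->|x0] := eqVneq (nrm x) 0; first by rewrite mulr0 nrm_ge0.
  have xp : 0 < nrm x by rewrite lt_def x0 nrm_ge0.
  have kx : nrm ((nrm x)^-1)%:C = (nrm x)^-1.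
    by rewrite nrm_real ger0_norm// invr_ge0 ltW.
  rewrite leNgt; apply/negP => xlt; apply: no_x.
  have [Tkx E] := linear_opZ Sl ((nrm x)^-1)%:C Tx.
  exists (((nrm x)^-1)%:C *: x); split => //; first by rewrite nrmZ kx mulVf.
  by rewrite [T _ - _]E nrmZ kx ltr_pdivrMl// mulrC.
have inv_le : (opnorm (inv_op (Defs.shift T l)) <= (eps^-1)%:E)%E.
  apply: opnorm_le => y Ty y1; have [Tx E] := inv_opP Ty.
  rewrite -(ler_pM2l eps0) mulfV ?gt_eqF// (le_trans (Tge _ Tx))//.
  by rewrite [T _ - _]E.
case: lT => [[]|[_]]; last by rewrite ltNge inv_le.
split; last by rewrite (le_lt_trans inv_le)// ltry.
have inj0 x : dom T x -> T x = l *: x -> x = 0.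
  move=> /Tge + E; rewrite E subrr nrm0 pmulr_rle0// => x0.
  by apply: nrm_eq0; apply/eqP; rewrite eq_le x0 nrm_ge0.
split => //.
- move=> x y; rewrite !inE => Tx Ty /= E; apply/subr0_eq.
  have [Txy E'] := linear_opB Sl Tx Ty.
  apply: inj0 => //; apply/subr0_eq; move: E' => /= ->.
  by rewrite E subrr.
- by move=> y _; have [x Tx E] := inj_surj inj0 y; exists x.
Qed.

End pseudospectrum.

(** * Finite-dimensional subspaces and the Fredholm alternative *)

Section finite_dim.
Variables (R : realType) (X Y : lmodType R[i]) (U : set X).
Hypothesis Ufin : finite_dim_subspace U.

Lemma findimD k x y : U x -> U y -> U (k *: x + y).
Proof.
move: Ufin => [m [b ->]] [p ->] [q ->]; exists (fun i => k * p i + q i).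
rewrite scaler_sumr -big_split; apply: eq_bigr => i _.
by rewrite scalerDl scalerA.
Qed.

Lemma findim0 : U 0.
Proof.
move: Ufin => [m [b ->]]; exists (fun=> 0).
by rewrite big1// => i _; rewrite scale0r.
Qed.

Lemma findimZ k x : U x -> U (k *: x).
Proof.
by move=> Ux; rewrite -[_ *: _]addr0; apply: findimD => //; apply: findim0.
Qed.

Lemma findimB x y : U x -> U y -> U (x - y).
Proof. by move=> Ux Uy; rewrite -scaleN1r addrC; apply: findimD. Qed.

Lemma findim_image (j : {linear X -> Y}) : finite_dim_subspace (j @` U).
Proof.
move: Ufin => [m [b ->]]; exists m, (j \o b); apply/seteqP; split.
  move=> _ [_ [k ->] <-]; exists k; rewrite linear_sum.
  by apply: eq_bigr => i _; rewrite linearZ.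
move=> _ [k ->]; exists (\sum_i k i *: b i); first by exists k.
by rewrite linear_sum; apply: eq_bigr => i _; rewrite linearZ.
Qed.

End finite_dim.

(* [T - mu = (T - K - mu) + K], where the first summand is invertible by
   Lax-Milgram; this leaves a problem on the range of [K]. *)
Lemma fredholm_finite_rank (R : realType) (H : hilbertType R) (T K : H -> H)
    (U : set H) (kappa : R) (mu : R[i]) :
  linear T -> linear K -> finite_dim_subspace U -> (forall x, U (K x)) ->
  0 <= kappa < nrm mu -> (forall x, nrm (T x - K x) <= kappa * nrm x) ->
  (forall x, T x = mu *: x -> x = 0) ->
  forall y, exists x, T x - mu *: x = y.
Proof.
move=> Tl Kl Ufin KU /andP[k0 kmu] TK Tinj y.
pose E x := T x - K x - mu *: x.
have El : linear E.
  move=> k x z; rewrite /E Tl Kl !scalerBr scalerDr !scalerA (mulrC mu) !opprD.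
  by rewrite [k *: T x + _ + _]addrACA [LHS]addrACA.
have Ebound x : nrm (E x) <= (kappa + nrm mu) * nrm x.
  by rewrite (le_trans (ler_nrmB _ _))// nrmZ mulrDl lerD2r.
have Ecoer x : (nrm mu - kappa) * nrm x ^+ 2 <= nrm (inner (E x) x).
  have -> : inner (E x) x = inner (T x - K x) x - mu * inner x x.
    by rewrite /E innerBl innerZl.
  rewrite mulrBl lerBlDr inner_nrm; set q := mu * _.
  have -> : nrm mu * nrm x ^+ 2 = nrm q.
    by rewrite nrmM nrm_real ger0_norm// sqr_ge0.
  have := ler_nrmB (inner (T x - K x) x) (inner (T x - K x) x - q).
  rewrite subKr addrC => /le_trans; apply; rewrite lerD2l.
  rewrite (le_trans (cauchy_schwarz _ _))// expr2 mulrA ler_wpM2r ?nrm_ge0//.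
have Einj x : E x = 0 -> x = 0.
  move=> Ex; have := Ecoer x; rewrite Ex linear0l nrm0 pmulr_rle0 ?subr_gt0//.
  move=> x0; apply: nrm_eq0; apply/eqP.
  by rewrite -sqrf_eq0 eq_le x0 sqr_ge0.
have EB x z : E (x - z) = E x - E z.
  by rewrite -scaleN1r addrC El scaleN1r addrC.
have /choice[S SE] h : exists s, E s = h.
  have S0 : 0 < nrm mu - kappa by rewrite subr_gt0.
  suff [s sP] : exists s, forall z, inner (E s) z = inner h z.
    by exists s; apply: inner_inj.
  apply: (@lax_milgram _ _ (fun x z => inner (E x) z) _ _ (inner h)
    (nrm mu - kappa) (kappa + nrm mu) (nrm h)) => //.
  - by move=> k x x' z; rewrite El innerDl innerZl.
  - by move=> x; exact: inner_antilinear.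
  - by rewrite addr_ge0// nrm_ge0.
  - exact: nrm_ge0.
  - move=> x z; rewrite (le_trans (cauchy_schwarz _ _))//.
    by rewrite ler_wpM2r ?nrm_ge0.
  - exact: inner_antilinear.
  - exact: cauchy_schwarz.
have SEK x : S (E x) = x by apply/subr0_eq/Einj; rewrite EB SE subrr.
have Sl : linear S.
  by move=> k x z; rewrite -{1}(SE x) -{1}(SE z) -El SEK.
(* For [x = S v] the equation reads [v + K (S v) = y]. With [v = y - u] it becomes
   [u + K (S u) = K (S y)], which can be solved for [u] inside [U]. *)
pose f u z := inner (u + K (S u)) z.
have U0 := findim0 Ufin.
have UB u : U u -> U (u + K (S u)).
  by move=> Uu; rewrite -[u]scale1r -[in S _](scale1r u); apply: findimD.
have fl k x x' z : f (k *: x + x') z = k * f x z + f x' z.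
  by rewrite /f Sl Kl addrACA -scalerDr [LHS]innerDl innerZl.
have [u Uu uU|u Uu uP] := findim_form_solve fl (fun x => inner_antilinear _)
    Ufin _ (inner_antilinear (K (S y))).
  have uKSu : u + K (S u) = 0.
    apply: nrm_eq0; apply/eqP; rewrite -sqrf_eq0; apply/eqP/complexI.
    by rewrite -inner_nrm; apply: uU; exact: UB.
  have Tu : T (S u) = mu *: S u.
    apply/subr0_eq; rewrite -uKSu; transitivity (E (S u) + K (S u)).
      by rewrite /E addrAC subrK.
    by rewrite SE.
  by rewrite -(SE u) (Tinj _ Tu); have := EB 0 0; rewrite !subrr.
have uE : u + K (S u) - K (S y) = 0.
  apply: nrm_eq0; apply/eqP; rewrite -sqrf_eq0; apply/eqP/complexI.
  rewrite -inner_nrm [LHS]innerBl; apply/eqP; rewrite subr_eq0; apply/eqP/uP.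
  by apply: findimB => //; exact: UB.
have KB x z : K (x - z) = K x - K z.
  by rewrite -scaleN1r addrC Kl scaleN1r addrC.
exists (S y - S u); transitivity (E (S y - S u) + K (S y - S u)).
  by rewrite /E addrAC subrK.
by rewrite EB KB !SE -[RHS]subr0 -uE opprB opprD !addrA [y - u + _]addrAC.
Qed.

(** * The operator of a coercive form and its inverse *)

Section form_operator.
Variables (R : realType) (H V : hilbertType R) (j : {linear V -> H}).
Variables (a : {sesquilinear V over R}) (c M gamma : R).
Hypotheses (j_inj : injective j) (j_dense : dense (range j)).
Hypotheses (c_gt0 : 0 < c) (j_le : forall x, nrm (j x) <= c * nrm x).
Hypotheses (M_gt0 : 0 < M) (gamma_gt0 : 0 < gamma).
Hypothesis a_bounded : forall x y, nrm (a x y) <= M * nrm x * nrm y.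
Hypothesis a_coercive : forall x, gamma * nrm x ^+ 2 <= complex.Re (a x x).

Let A := form_op j a.

Lemma form_linear k x y z : a (k *: x + y) z = k * a x z + a y z.
Proof. exact: linearPl. Qed.

Lemma form_antilinear x : antilinear (a x).
Proof. by move=> k y z; rewrite linearPr. Qed.

Lemma formBl x y z : a (x - y) z = a x z - a y z.
Proof. exact: linearBl. Qed.

Lemma formBr x y z : a z (x - y) = a z x - a z y.
Proof. exact: linearBr. Qed.

Lemma form_eq0 x : a x x = 0 -> x = 0.
Proof.
move=> ax0; have := a_coercive x; rewrite ax0 pmulr_rle0// => x0.
by apply: nrm_eq0; apply/eqP; rewrite -sqrf_eq0 eq_le x0 sqr_ge0.
Qed.

(** If [u != 0] were orthogonal to the dense range, some [j y] would be closer to [u] than [|u|],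
    and [|u|^2 = <u, u - j y> < |u|^2]. *)
Lemma range_inner_inj f g : (forall y, inner f (j y) = inner g (j y)) -> f = g.
Proof.
move=> fg; apply/subr0_eq; set u := f - g.
have uj y : inner u (j y) = 0 by rewrite innerBl fg subrr.
apply: nrm_eq0; apply/eqP; apply: contrapT => /negP u0.
have up : 0 < nrm u by rewrite lt_def u0 nrm_ge0.
have up' : 0 < (nrm u)%:C by rewrite ltcR.
have [|z [+ [y _ yz]]] := j_dense _ (ball_open u (nrm u)%:C).
  by exists u; exact: ballxx.
rewrite -yz -ball_normE/= nrmE ltcR => uy.
have := cauchy_schwarz u (u - j y).
rewrite innerBr uj subr0 inner_nrm nrm_real ger0_norm ?sqr_ge0//.
by rewrite expr2 ler_pM2l// leNgt uy.
Qed.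

(** Injectivity of [j] and density of its range leave [xget] only one candidate. *)
Lemma form_op_eq x f : (forall y, a x y = inner f (j y)) ->
  dom A (j x) /\ A (j x) = f.
Proof.
move=> xf; split.
  (* The summand [1] keeps the constant positive when [f = 0]. *)
  exists x => //; exists (nrm f + 1); first by rewrite ltr_wpDl ?nrm_ge0.
  move=> y; rewrite xf (le_trans (cauchy_schwarz _ _))// ler_wpM2r ?nrm_ge0//.
  by rewrite lerDl.
rewrite /A/=; case: xgetP => [g _ [x' /j_inj -> x'g]|/(_ f)[]].
  by apply: range_inner_inj => y; rewrite -x'g xf.
by exists x.
Qed.

(** Membership in the domain bounds [a x] by the norm of [H], so [riesz_range] with [C := j] gives a
    representing vector in [H]. *)
Lemma form_opP h : dom A h ->
  exists2 x, j x = h & forall y, a x y = inner (A h) (j y).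
Proof.
move=> [x [k k0 xk] <-]; exists x => //.
have [f xf] := riesz_range (linearP j) (form_antilinear x) (ltW k0) xk.
by have [_ ->] := form_op_eq (fun y => esym (xf y)).
Qed.

Lemma linear_form_op : linear_op A.
Proof.
split.
  rewrite -(linear0 j); apply: (form_op_eq (f := 0) _).1 => y.
  by rewrite !linear0l.
move=> k _ _ /form_opP[x <- xE] /form_opP[y <- yE].
rewrite -linearP; apply: form_op_eq => z.
by rewrite form_linear innerDl innerZl xE yE.
Qed.

Lemma form_solution_bound x f : (forall y, a x y = inner f (j y)) ->
  gamma * nrm x <= c * nrm f.
Proof.
move=> xf; have [->|x0] := eqVneq (nrm x) 0.
  by rewrite mulr0 mulr_ge0 ?nrm_ge0// ltW.
have xp : 0 < nrm x by rewrite lt_def x0 nrm_ge0.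
rewrite -(ler_pM2r xp) -mulrA -expr2 (le_trans (a_coercive x))// xf.
rewrite (le_trans (Re_le_nrm _))// (le_trans (cauchy_schwarz _ _))//.
by rewrite [c * _]mulrC -mulrA ler_wpM2l ?nrm_ge0.
Qed.

Lemma form_op_surj f : (A @` dom A) f.
Proof.
have [x xf] : exists x, forall y, a x y = inner f (j y).
  apply: (@lax_milgram _ _ a form_linear form_antilinear
    (fun y => inner f (j y)) gamma M (nrm f * c)) => //.
  - exact: ltW.
  - by rewrite mulr_ge0// ?nrm_ge0// ltW.
  - by move=> x; rewrite (le_trans (a_coercive x))// Re_le_nrm.
  - by move=> k x y; rewrite linearP innerDr innerZr.
  - move=> y; rewrite (le_trans (cauchy_schwarz _ _))// -mulrA.
    by rewrite ler_wpM2l ?nrm_ge0.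
by have [Ax Axf] := form_op_eq xf; exists (j x).
Qed.

Lemma inv_form_opP f :
  exists2 x, j x = inv_op A f & forall y, a x y = inner f (j y).
Proof.
have [Af fE] := inv_opP (form_op_surj f).
by have [x xE xf] := form_opP Af; exists x => // y; rewrite xf fE.
Qed.

Lemma inv_form_op_eq x f : (forall y, a x y = inner f (j y)) ->
  inv_op A f = j x.
Proof.
move=> xf; have [x' <- x'f] := inv_form_opP f; congr (j _).
by apply/subr0_eq/form_eq0; rewrite formBl x'f xf subrr.
Qed.

Lemma linear_inv_form_op : linear (inv_op A).
Proof.
move=> k f g.
have [[x <- xf] [y <- yg]] := (inv_form_opP f, inv_form_opP g).
rewrite -linearP; apply: inv_form_op_eq => z.
by rewrite form_linear innerDl innerZl xf yg.
Qed.

(** The embedding constant enters twice: through [form_solution_bound] and through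
    [|j x| <= c |x|]. *)
Lemma inv_form_op_bound f : nrm (inv_op A f) <= c ^+ 2 / gamma * nrm f.
Proof.
have [x <- /form_solution_bound xf] := inv_form_opP f.
rewrite (le_trans (j_le x))// mulrAC ler_pdivlMr// expr2 -2!mulrA.
by rewrite ler_pM2l// mulrC.
Qed.

Lemma opnorm_inv_form_op : (opnorm (inv_op A) <= (c ^+ 2 / gamma)%:E)%E.
Proof.
apply: opnorm_le => f _ f1; rewrite (le_trans (inv_form_op_bound f))//.
by rewrite ler_piMr// divr_ge0 ?sqr_ge0// ltW.
Qed.

(** * Galerkin approximation *)

Section galerkin.
Variable U : set V.
Hypothesis U_findim : finite_dim_subspace U.

Lemma galerkin_solution f :
  exists2 z, U z & forall v, U v -> a z v = inner f (j v).
Proof.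
apply: (findim_form_solve form_linear form_antilinear U_findim).
  by move=> x Ux ax0; apply: form_eq0; exact: ax0.
by move=> k x y; rewrite linearP innerDr innerZr.
Qed.

(** By Galerkin orthogonality [a (x - z)] vanishes on [U], so
    [a (x - z) (x - z) = a (x - z) (x - q)]; coercivity bounds the left side below, boundedness the
    right side above. *)
Lemma cea x z f q : (forall v, a x v = inner f (j v)) ->
  U z -> (forall v, U v -> a z v = inner f (j v)) -> U q ->
  gamma * nrm (x - z) <= M * nrm (x - q).
Proof.
move=> xf Uz zf Uq.
have orth v : U v -> a (x - z) v = 0 by move=> Uv; rewrite formBl xf zf// subrr.
have [->|x0] := eqVneq (nrm (x - z)) 0.
  by rewrite mulr0 mulr_ge0 ?nrm_ge0// ltW.
have xp : 0 < nrm (x - z) by rewrite lt_def x0 nrm_ge0.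
rewrite -(ler_pM2r xp) -mulrA -expr2 (le_trans (a_coercive _))//.
have -> : a (x - z) (x - z) = a (x - z) (x - q).
  apply/subr0_eq; rewrite -formBr.
  have -> : x - z - (x - q) = q - z by rewrite opprB addrC addrA subrK.
  by apply: orth; exact: findimB.
rewrite (le_trans (Re_le_nrm _))// (le_trans (a_bounded _ _))//.
by rewrite mulrAC.
Qed.

Lemma inv_form_op_on_eq y z : U y -> j y != 0 -> U z ->
  (forall v, U v -> a z v = inner (j y) (j v)) ->
  dom (inv_op (form_op_on j a U)) (j y) /\
  inv_op (form_op_on j a U) (j y) = j z.
Proof.
move=> Uy y0 Uz zy; set An := form_op_on j a U.
have An_z : An (j z) = j y.
  rewrite /An/=; case: xgetP => [g _ [[y' Uy' <-] [x' [_ /j_inj->] x'y']]|].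
    apply/subr0_eq/nrm_eq0; apply/eqP; rewrite -sqrf_eq0; apply/eqP/complexI.
    rewrite -inner_nrm innerBl -linearB -x'y' ?zy ?subrr//; exact: findimB.
  by move=> /(_ (j y))[]; split; [exists y|exists z].
have dom_y : dom (inv_op An) (j y) by exists (j z) => //; exists z.
(* [inv_op] only returns some preimage [j z'] of [j y]. If [form_op_on] took its default value [0]
   there, [j y] would be [0]; otherwise coercivity gives [z' = z]. *)
split=> //; have [[z' Uz' z'E] Anz'] := inv_opP dom_y.
rewrite -z'E in Anz' *; congr (j _).
move: Anz'; rewrite /An/=; case: xgetP => [g _ [_ [x' [_ /j_inj->] x'g]]|_].
  move=> gy; apply/subr0_eq/form_eq0; rewrite formBl x'g ?zy ?gy ?subrr//.
    exact: findimB.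
  exact: findimB.
by move=> jy0; rewrite -jy0 eqxx in y0.
Qed.

End galerkin.

End form_operator.

(** * The enclosure of the pseudospectrum *)

Theorem theorem5p2 (R : realType) (H V W : hilbertType R)
    (jV : {linear V -> H}) (c : R)
    (jV_inj : injective jV) (jV_dense : dense (range jV))
    (c_gt0 : 0 < c) (jV_le : forall x : V, nrm (jV x) <= c * nrm x)
    (a : {sesquilinear V over R}) (M gamma : R)
    (M_gt0 : 0 < M) (gamma_gt0 : 0 < gamma)
    (a_bounded : forall x y : V, nrm (a x y) <= M * nrm x * nrm y)
    (a_coercive : forall x : V, gamma * nrm x ^+ 2 <= complex.Re (a x x))
    (U : nat -> set V)
    (U_findim : forall n, finite_dim_subspace (U n))
    (U_incr : forall n, U n `<=` U n.+1)
    (jW : {linear W -> H})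
    (jW_inj : injective jW) (jW_dense : dense (range jW))
    (jW_cont : continuous jW)
    (domA_W : dom (form_op jV a) `<=` range jW)
    (I : {linear W -> V}) (I_emb : forall w : W, jV (I w) = jW w)
    (Q : nat -> {linear W -> V})
    (Q_cont : forall n, continuous (Q n))
    (Q_range : forall n (w : W), U n (Q n w))
    (Q_lim : opnorm (total_op (fun w : W => I w - Q n w)) @[n --> \oo] --> 0%E)
    (r eps delta : R) (n0 : nat) :
  let A := form_op jV a in
  let An n := form_op_on jV a (U n) in
  let nA := fine (opnorm (inv_op A)) in
  let nAW := fine (opnorm (corestrict jW (inv_op A))) in
  let delta0 := nA ^+ 2 * eps / (1 - nA * eps) in
  0 < r ->
  0 < eps < nA^-1 ->
  delta0 < delta <= delta0 + 7 / 2 * nA ->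
  (forall n, (n0 <= n)%N ->
    (opnorm (total_op (fun w : W => I w - Q n w)%R) <
     ((delta - delta0) /
      (c * nAW * (M / gamma + (r + eps) * (7 * c ^+ 2 / gamma))))%R%:E)%E) ->
  forall n, (n0 <= n)%N ->
    pseudospectrum eps A `&` closure (disc r)
      `<=` inv_set (nbhd delta (numerical_range (inv_op (An n)))).
Proof.
move=> A An nA nAW delta0 r0 /andP[eps0 eps_nA].
move=> /andP[delta0_lt delta_le] Qn n n0n.
have {Qn n0n}Qn := Qn n n0n.
set T := inv_op A.
have A_linear : linear_op A := linear_form_op a jV_inj jV_dense.
have T_linear : linear T := linear_inv_form_op jV_inj jV_dense c_gt0 jV_le M_gt0
  gamma_gt0 a_bounded a_coercive.
have TP f : exists2 x, jV x = T f & forall y, a x y = inner f (jV y).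
  exact: (inv_form_opP jV_inj jV_dense c_gt0 jV_le M_gt0 gamma_gt0 a_bounded
    a_coercive).
have T_eq x f := @inv_form_op_eq _ _ _ jV a c M gamma jV_inj jV_dense c_gt0
  jV_le M_gt0 gamma_gt0 a_bounded a_coercive x f.
have AT f : dom A (T f) /\ A (T f) = f.
  by have [x <- /(form_op_eq jV_inj jV_dense)] := TP f.
have TA h : dom A h -> T (A h) = h.
  by move=> /(form_opP jV_inj jV_dense)[x <- xf]; exact: T_eq.
have domT f : dom T f by have [Af Tf] := AT f; exists (T f).
have T_op : linear_op T.
  by split=> [|k f g _ _]; [|split; [|exact: T_linear]]; exact: domT.
have T_ge0 : (0 <= opnorm T)%E := opnorm_ge0 (domT 0).
have T_le : (opnorm T <= (c ^+ 2 / gamma)%:E)%E.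
  exact: (opnorm_inv_form_op jV_inj jV_dense c_gt0 jV_le M_gt0 gamma_gt0
    a_bounded a_coercive).
have T_fin : (opnorm T < +oo)%E by rewrite (le_lt_trans T_le)// ltry.
have nA_le : nA <= c ^+ 2 / gamma.
  by rewrite -lee_fin fineK// ge0_fin_numE.
have T_bound f : nrm (T f) <= nA * nrm f.
  by apply: (opnorm_ub T_fin _ (domT f)) => k x; exact: linear_opZ.
(* As [0^-1 = 0], the bounds [0 < eps < nA^-1] exclude [nA = 0]. *)
have nA_gt0 : 0 < nA by rewrite -invr_gt0 (lt_trans eps0).
have nA_eps : nA * eps < 1 by rewrite mulrC -ltr_pdivlMr// div1r.
pose w f := corestrict jW T f.
have wE f : jW (w f) = T f.
  by rewrite /w /= pinvK// inE; apply: domA_W; have [] := AT f.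
have w_linear : linear w.
  by move=> k f g; apply: jW_inj; rewrite linearP !wE T_linear.
have w_op : linear_op (corestrict jW T).
  by split=> [|k f g _ _]; [|split; [|exact: w_linear]]; exact: domT.
have w_ge0 : (0 <= opnorm (corestrict jW T))%E.
  by apply: opnorm_ge0; exact: domT.
have q_fin_ge0 : (0 <= opnorm (total_op (fun v => (I v - Q n v)%R)))%E.
  by apply: opnorm_ge0.
(* The closed graph theorem is not needed here: if [A^-1] were unbounded into
   [W], then [nAW = 0] and the bound in [Qn] would be [_ / 0 = 0]. *)
have nAW_neq0 : nAW != 0.
  apply/eqP => nAW0; move: Qn.
  by rewrite nAW0 mulr0 mul0r invr0 mulr0 ltNge q_fin_ge0.
have nAW_gt0 : 0 < nAW by rewrite lt_def nAW_neq0 fine_ge0.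
have w_fin : (opnorm (corestrict jW T) < +oo)%E.
  rewrite ltNge leye_eq; apply: contra nAW_neq0 => /eqP wy.
  by rewrite /nAW -/T wy.
have w_bound f : nrm (w f) <= nAW * nrm f.
  by apply: (opnorm_ub w_fin _ (domT f)) => k x; exact: linear_opZ.
set D := M / gamma + _ in Qn.
have D_gt0 : 0 < D.
  rewrite ltr_wpDr ?divr_gt0// mulr_ge0 ?addr_ge0 ?ltW//.
  by rewrite divr_gt0 ?mulr_gt0 ?exprn_gt0.
pose q := fine (opnorm (total_op (fun v => I v - Q n v))).
have q_ge0 : 0 <= q by exact: fine_ge0.
have q_fin : (opnorm (total_op (fun v => (I v - Q n v)%R)) < +oo)%E.
  by rewrite (lt_trans Qn)// ltry.
have q_bound v : nrm (I v - Q n v) <= q * nrm v.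
  apply: (@opnorm_ub _ _ _ (total_op (fun v => I v - Q n v)) v q_fin _ Logic.I).
  move=> k x _; split=> //=.
  by rewrite (linearZ_LR I) (linearZ_LR (Q n)) scalerBr.
have q_lt : q < (delta - delta0) / (c * nAW * D).
  by rewrite -lte_fin fineK// ge0_fin_numE.
(* [kappa] bounds [T - jV Q_n w] on [H]: [nAW] for the map into [W], [q] for [I - Q_n], [c] for the
   embedding of [V]. *)
pose kappa := c * q * nAW.
have kappa_ge0 : 0 <= kappa by rewrite !mulr_ge0// ltW.
have kappa_lt : kappa * D < delta - delta0.
  have -> : kappa * D = q * (c * nAW * D) by rewrite /kappa; ring.
  by rewrite -ltr_pdivlMr// !mulr_gt0.
(* The upper bound on [delta] enters here: with [G = c^2 / gamma], [7 G kappa (r + eps) <= kappa D <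
   7/2 nA <= 7/2 G]. *)
have kappa_r : kappa * (r + eps) < 2^-1.
  have G0 : 0 < c ^+ 2 / gamma by rewrite divr_gt0// exprn_gt0.
  rewrite -(ltr_pM2r G0).
  have : 0 <= kappa * (M / gamma) by rewrite mulr_ge0// divr_ge0// ltW.
  move: kappa_lt delta_le nA_le; rewrite /D -[7 * _ / _]mulrA.
  move: (c ^+ 2 / gamma) => G; nra.
have K_bound f : nrm (T f - jV (Q n (w f))) <= kappa * nrm f.
  rewrite -wE -I_emb -linearB (le_trans (jV_le _))// -!mulrA ler_pM2l//.
  by rewrite (le_trans (q_bound _))// ler_wpM2l.
move=> l [l_eps l_r].
have l_le : nrm l <= r.
  apply/ler_addgt0Pr => e e0.
  have e0' : 0 < e%:C by rewrite ltcR.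
  have [z [zr]] := l_r _ (nbhsx_ballx (l : R[i]^o) _ e0').
  rewrite -ball_normE/= nrmE ltcR => lz.
  have := ler_nrmD (l - z) z; rewrite subrK => /le_trans; apply.
  by rewrite addrC lerD// ltW.
have [h [Ah h1 h_eps]] :
    exists h, [/\ dom A h, nrm h = 1 & nrm (A h - l *: h) < eps].
  apply: pseudospectrum_approx l_eps => // A_inj y.
  (* For [l = 0] the solution is [T y]. Otherwise [x = T f] turns [A x - l x = y] into
     [T f - l^-1 f = - l^-1 y], and [kappa |l| < 1] allows [fredholm_finite_rank]. *)
  have [->|l0] := eqVneq l 0.
    by have [? E] := AT y; exists (T y) => //; rewrite scale0r subr0.
  pose K f := jV (Q n (w f)).
  have K_linear : linear K.
    by move=> k f g; rewrite /K w_linear !linearP.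
  have T_inj f : T f = l^-1 *: f -> f = 0.
    move=> Tf; have [ATf E] := AT f.
    have Tf0 : T f = 0.
      by apply: A_inj => //; rewrite E Tf scalerA divff// scale1r.
    by rewrite -E Tf0 (linear_op0 A_linear).
  have kappa_l : 0 <= kappa < nrm l^-1.
    rewrite kappa_ge0/= nrmV -[ltRHS]mul1r ltr_pdivlMr; last first.
      by rewrite lt_def nrm_ge0 andbT; apply: contra l0 => /eqP/nrm_eq0 ->.
    have : kappa * nrm l <= kappa * (r + eps).
      by rewrite ler_wpM2l// ler_wpDr// ltW.
    by move: kappa_r; lra.
  have KU f : (jV @` U n) (K f) by exists (Q n (w f)).
  have [x xy] := fredholm_finite_rank T_linear K_linear
    (findim_image (U_findim n) jV) KU kappa_l K_bound T_inj (- l^-1 *: y).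
  have [ATx E] := AT x; exists (T x) => //; rewrite E.
  have -> : T x = l^-1 *: x - l^-1 *: y.
    by rewrite -scaleNr -xy addrC subrK.
  by rewrite scalerBr !scalerA divff// !scale1r opprB addrC subrK.
pose u := A h - l *: h.
have hE : h = l *: T h + T u.
  by rewrite -T_linear /u addrC subrK TA.
have Tu_le : nrm (T u) <= nA * eps.
  by rewrite (le_trans (T_bound u))// ler_wpM2l ?ltW.
(* Taking norms in [hE] keeps [l] away from [0] and bounds [1 / |l|] by [nA / (1 - nA eps)], the
   source of the denominator in [delta0]. *)
have l_nA : 1 - nA * eps <= nrm l * nA.
  rewrite lerBlDr -h1 {1}hE (le_trans (ler_nrmD _ _))// lerD// nrmZ.
  by rewrite ler_wpM2l ?nrm_ge0// (le_trans (T_bound h))// h1 mulr1.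
have l0 : l != 0.
  by apply: contraTneq l_nA => ->; rewrite nrm0 mul0r -ltNge subr_gt0.
have l_gt0 : 0 < nrm l.
  by rewrite lt_def nrm_ge0 andbT; apply: contra l0 => /eqP/nrm_eq0 ->.
pose mu := l^-1.
have near_h : nrm (inner (T h) h - mu) <= delta0.
  have -> : inner (T h) h - mu = inner (- (mu *: T u)) h.
    have -> : - (mu *: T u) = T h - mu *: h.
      by rewrite {2}hE scalerDr scalerA mulVf// scale1r opprD addrA subrr add0r.
    by rewrite innerBl innerZl inner_nrm h1 expr1n mulr1.
  rewrite (le_trans (cauchy_schwarz _ _))// h1 mulr1 nrmN nrmZ nrmV.
  rewrite mulrC ler_pdivrMr// (le_trans Tu_le)// /delta0.
  rewrite mulrAC ler_pdivlMr ?subr_gt0//.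
  have -> : nA ^+ 2 * eps * nrm l = nA * eps * (nrm l * nA) by ring.
  by rewrite ler_wpM2l// mulr_ge0// ltW.
(* Since [h = T (A h)] and [|A h| <= r + eps], this vector of [U n] approximates [h] up to [eta],
   and [eta < 1/2] keeps it nonzero. *)
pose y := Q n (w (A h)).
pose eta := kappa * (r + eps).
have h_y : nrm (h - jV y) <= eta.
  rewrite -{1}(TA h Ah) (le_trans (K_bound _))// ler_wpM2l//.
  have -> : A h = l *: h + u by rewrite /u addrC subrK.
  by rewrite (le_trans (ler_nrmD _ _))// nrmZ h1 mulr1 lerD// ltW.
have y_ge : 1 - eta <= nrm (jV y).
  have := ler_nrmD (h - jV y) (jV y); rewrite subrK h1.
  by clear -h_y; lra.
have y_le : nrm (jV y) <= 1 + eta.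
  have := ler_nrmB h (h - jV y); rewrite subKr h1.
  by clear -h_y; lra.
have y_gt0 : 0 < nrm (jV y).
  have eta_lt : eta < 2^-1 := kappa_r.
  by clear -y_ge eta_lt; lra.
pose yh := ((nrm (jV y))^-1)%:C *: y.
have Uyh : U n yh by apply: findimZ => //; exact: Q_range.
have yh1 : nrm (jV yh) = 1.
  rewrite linearZ nrmZ nrm_real ger0_norm ?invr_ge0 ?nrm_ge0// mulVf//.
  by rewrite gt_eqF.
(* One [eta] is the distance from [h] to [jV y], the other bounds the change under normalisation,
   which is the distance from [|jV y|] to [1]. *)
have h_yh : nrm (jV yh - h) <= 2 * eta.
  have -> : jV yh - h = (jV yh - jV y) - (h - jV y).
    by rewrite opprB addrA subrK.
  rewrite (le_trans (ler_nrmB _ _))// mulr_natl mulr2n lerD//.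
  have -> : jV yh - jV y = ((nrm (jV y))^-1 - 1)%:C *: jV y.
    by rewrite linearZ rmorphB scalerBl rmorph1 scale1r.
  rewrite nrmZ nrm_real -[X in _ * X](ger0_norm (nrm_ge0 (jV y))) -normrM.
  rewrite mulrBl mul1r mulVf ?gt_eqF// ler_norml.
  by clear -y_ge y_le; lra.
have [z Uz zP] :=
  galerkin_solution jV gamma_gt0 a_coercive (U_findim n) (jV yh).
have [t tE tP] := TP (jV yh).
have t_z : nrm (jV z - T (jV yh)) <= kappa * (M / gamma).
  have tI : t = I (w (jV yh)) by apply: jV_inj; rewrite tE I_emb wE.
  have tz := cea M_gt0 a_bounded a_coercive (U_findim n) tP Uz zP
    (Q_range n (w (jV yh))).
  rewrite -tE -linearB (le_trans (jV_le _))// nrm_subC mulrA ler_pdivlMr//.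
  rewrite /kappa -!mulrA ler_pM2l// mulrC (le_trans tz)// mulrA [leRHS]mulrC.
  rewrite ler_pM2l// {1}tI (le_trans (q_bound _))// ler_wpM2l//.
  by rewrite (le_trans (w_bound _))// yh1 mulr1.
have yh0 : jV yh != 0.
  by apply: contra_eqN yh1 => /eqP ->; rewrite nrm0 eq_sym oner_eq0.
have [dom_yh An_yh] := inv_form_op_on_eq jV_inj gamma_gt0 a_coercive
  (U_findim n) Uyh yh0 Uz zP.
exists mu; last by rewrite invrK.
split; last by move/eqP; rewrite invr_eq0 (negPf l0).
apply: (@le_lt_trans _ _ (nrm (mu - inner (jV z) (jV yh)))%:E).
  apply: ereal_inf_lbound; exists (inner (jV z) (jV yh)) => //.
  by exists (jV yh) => //; rewrite An_yh.
rewrite lte_fin nrm_subC.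
(* The terms are the Galerkin error, the replacement of [jV yh] by [h] in each argument of
   [<T h, h>], and the pseudospectral error [near_h]. *)
have -> : inner (jV z) (jV yh) - mu = inner (jV z - T (jV yh)) (jV yh)
    + (inner (T (jV yh - h)) (jV yh) + inner (T h) (jV yh - h))
    + (inner (T h) h - mu).
  have -> : T (jV yh - h) = T (jV yh) - T h.
    by have [_ ->] := linear_opB T_op (domT (jV yh)) (domT h).
  rewrite !innerBl !innerBr; ring.
have eta_ge0 : 0 <= eta by rewrite mulr_ge0// addr_ge0 ?ltW.
have e1 : nrm (inner (jV z - T (jV yh)) (jV yh)) <= kappa * (M / gamma).
  by rewrite (le_trans (cauchy_schwarz _ _))// yh1 mulr1.
have e2 : nrm (inner (T (jV yh - h)) (jV yh)) <= nA * (2 * eta).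
  rewrite (le_trans (cauchy_schwarz _ _))// yh1 mulr1.
  by rewrite (le_trans (T_bound _))// ler_wpM2l// ltW.
have e3 : nrm (inner (T h) (jV yh - h)) <= nA * (2 * eta).
  rewrite (le_trans (cauchy_schwarz _ _))// ler_pM ?nrm_ge0//.
  by rewrite (le_trans (T_bound _))// h1 mulr1.
have e23 := le_trans (ler_nrmD _ _) (lerD e2 e3).
have e123 := le_trans (ler_nrmD _ _) (lerD e1 e23).
apply: (le_lt_trans (le_trans (ler_nrmD _ _) (lerD e123 near_h))).
(* The first three terms total at most [kappa (M / gamma) + 4 nA eta], which is at most [kappa D]
   because [nA <= c^2 / gamma]. *)
have : nA * eta <= c ^+ 2 / gamma * eta by rewrite ler_wpM2r.
have : 0 <= c ^+ 2 / gamma * eta by rewrite mulr_ge0// (le_trans (ltW nA_gt0)).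
have : kappa * D = kappa * (M / gamma) + 7 * (c ^+ 2 / gamma * eta).
  by rewrite /D /eta; ring.
by move: kappa_lt; lra.
Qed.
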